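(* Let $G$ be a finite group. There is an exact sequence of abelian groups $$0\longrightarrow \mathbb{Z}\longrightarrow B^*(G)\xrightarrow{\ r_G\ }\varprojlim_{1<H\le G}B^*(N_G(H)/H)\longrightarrow 0,$$ where $r_G(f)=(\mathrm{Des}^G_{N_G(H)/H}f)_{1<H\le G}$.
   Context: $B^*(G)=\mathrm{Hom}_{\mathbb{Z}}(B(G),\mathbb{Z})$ is the $\mathbb{Z}$-dual of the Burnside ring of $G$, identified with the group of super class functions: functions $f$ from the set of subgroups of $G$ to $\mathbb{Z}$ that are constant on conjugacy classes of subgroups, with $f(H)=f(G/H)$. The destriction map (restriction followed by deflation) $\mathrm{Des}^G_{N_G(H)/H}:B^*(G)\to B^*(N_G(H)/H)$ is given by $(\mathrm{Des}^G_{N_G(H)/H}f)(L/H)=f(L)$ for $H\le L\le N_G(H)$. Likewise for restriction, $(\mathrm{Res}^G_Kf)(L)=f(L)$ for $L\le K$. $\varprojlim_{1<H\le G}B^*(N_G(H)/H)$ is the group of gluing data: sequences $(f_H)_{1<H\le G}$ indexed by the nontrivial subgroups of $G$, with $f_H\in B^*(N_G(H)/H)$, such that: (i) ${}^gf_H=f_{{}^gH}$ for all $g\in G$ and $1\neq H\le G$, where ${}^g(-)$ is transport of structure by conjugation by $g$; (ii) for all nontrivial subgroups $H\trianglelefteq K$ of $G$, with $N_G(H,K)=N_G(H)\cap N_G(K)$, $$\mathrm{Des}^{N_G(H)/H}_{N_G(H,K)/K}f_H=\mathrm{Res}^{N_G(K)/K}_{N_G(H,K)/K}f_K,$$ where the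 left-hand map is restriction to $N_G(H,K)/H$ followed by deflation to $N_G(H,K)/K$; explicitly $f_H(L/H)=f_K(L/K)$ for all $K\le L\le N_G(H,K)$. *)

(* Defs.v *)
From HB Require Import structures.
From mathcomp Require Import all_boot all_order all_fingroup all_algebra.

Set Implicit Arguments.
Unset Strict Implicit.
Unset Printing Implicit Defensive.

Import GRing.Theory.

Local Open Scope group_scope.
Local Open Scope ring_scope.

(* Dependent finite products of abelian groups (MathComp only provides the    *)
(* non-dependent case).                                                       *)
Section DffunZmod.
Variables (I : finType) (V : I -> zmodType).
Local Notation VI := {dffun forall i : I, V i}.

Definition dffun_zero : VI := [ffun i => 0 : V i].
Definition dffun_opp (f : VI) : VI := [ffun i => - f i : V i].
Definition dffun_add (f g : VI) : VI := [ffun i => f i + g i : V i].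

Fact dffun_addA : associative dffun_add.
Proof. by move=> f g h; apply/ffunP=> i; rewrite !ffunE addrA. Qed.
Fact dffun_addC : commutative dffun_add.
Proof. by move=> f g; apply/ffunP=> i; rewrite !ffunE addrC. Qed.
Fact dffun_add0 : left_id dffun_zero dffun_add.
Proof. by move=> f; apply/ffunP=> i; rewrite !ffunE add0r. Qed.
Fact dffun_addN : left_inverse dffun_zero dffun_opp dffun_add.
Proof. by move=> f; apply/ffunP=> i; rewrite !ffunE addNr. Qed.

HB.instance Definition _ :=
  GRing.isZmodule.Build VI dffun_addA dffun_addC dffun_add0 dffun_addN.

Lemma dffun_subE (f g : VI) i : (f - g) i = f i - g i.
Proof. by rewrite !ffunE. Qed.
End DffunZmod.

(* B^*(G), as super class functions. As for 'CF(G), a function on the         *)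
(* subgroups of G is extended by 0 to all of {group gT}.                      *)
Section SuperClassFunctions.
Variables (gT : finGroupType) (G : {group gT}).
Implicit Types (f : {ffun {group gT} -> int}) (L : {group gT}).

Definition is_scf : {pred {ffun {group gT} -> int}} := fun f =>
  [forall L : {group gT}, ~~ (L \subset G) ==> (f L == 0)]
  && [forall L : {group gT}, [forall x in G, f (L :^ x)%G == f L]].

Lemma is_scfP f :
  reflect ((forall L, ~~ (L \subset G) -> f L = 0)
           /\ (forall L x, x \in G -> f (L :^ x)%G = f L))
          (f \in is_scf).
Proof.
apply: (iffP andP) => [[/forallP s /forallP c]|[s c]]; split.
- by move=> L nLG; apply/eqP/(implyP (s L)).
- by move=> L x Gx; apply/eqP/(forall_inP (c L)).
- by apply/forallP=> L; apply/implyP=> nLG; rewrite s.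
by apply/forallP=> L; apply/forall_inP=> x Gx; rewrite c.
Qed.

Fact is_scf_zmod_closed : zmod_closed is_scf.
Proof.
split=> [|f g /is_scfP[sf cf] /is_scfP[sg cg]]; apply/is_scfP; split.
- by move=> L _; rewrite ffunE.
- by move=> L x _; rewrite !ffunE.
- by move=> L nLG; rewrite !ffunE sf ?sg ?subr0.
by move=> L x Gx; rewrite !ffunE cf ?cg.
Qed.
HB.instance Definition _ :=
  GRing.isZmodClosed.Build {ffun {group gT} -> int} is_scf is_scf_zmod_closed.

Record Bstar := SCF { scf_val :> {ffun {group gT} -> int};
                      scf_valP : scf_val \in is_scf }.

HB.instance Definition _ := [isSub for scf_val].
HB.instance Definition _ := [Choice of Bstar by <:].
HB.instance Definition _ := [SubChoice_isSubZmodule of Bstar by <:].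

Lemma scfP (f g : Bstar) : (forall L, L \subset G -> f L = g L) -> f = g.
Proof.
move=> eqfg; apply/val_inj/ffunP=> L.
have [/eqfg//|nLG] := boolP (L \subset G).
have [/is_scfP[sf _] /is_scfP[sg _]] := (scf_valP f, scf_valP g).
by rewrite [LHS]sf ?[RHS]sg.
Qed.

Lemma scfJ (f : Bstar) L x : x \in G -> f (L :^ x)%G = f L.
Proof. by have /is_scfP[_ cf] := scf_valP f; apply: cf. Qed.

Lemma scfB (f g : Bstar) L : (f - g) L = f L - g L.
Proof. by rewrite !ffunE. Qed.

Fact mkscf_subproof (F : {group gT} -> int) :
    (forall L x, x \in G -> L \subset G -> F (L :^ x)%G = F L) ->
  [ffun L : {group gT} => if L \subset G then F L else 0] \in is_scf.
Proof.
move=> cF; apply/is_scfP; split=> [L /negPf nLG | L x Gx].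
  by rewrite ffunE nLG.
by rewrite !ffunE /= -{1}(conjGid Gx) conjSg; case: ifP => // sLG; rewrite cF.
Qed.

Definition mkscf F cF := SCF (@mkscf_subproof F cF).

Lemma mkscfE F cF L : L \subset G -> @mkscf F cF L = F L.
Proof. by move=> sLG; rewrite ffunE sLG. Qed.
End SuperClassFunctions.

(* Restriction to K; it is 0 by convention unless K \subset G.                *)
Section Restriction.
Variables (gT : finGroupType) (K G : {group gT}).

Fact scfRes_subproof (f : Bstar G) (L : {group gT}) x : x \in K -> L \subset K ->
  (if K \subset G then f (L :^ x)%G else 0) = if K \subset G then f L else 0.
Proof. by move=> Kx _; case: ifP => // /subsetP sKG; rewrite scfJ ?sKG. Qed.

Definition scfRes (f : Bstar G) : Bstar K := mkscf (scfRes_subproof f).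

Lemma scfResE f (L : {group gT}) :
  K \subset G -> L \subset K -> scfRes f L = f L.
Proof. by move=> sKG sLK; rewrite mkscfE // sKG. Qed.

Fact scfRes_is_zmod_morphism : zmod_morphism scfRes.
Proof.
by move=> f g; apply: scfP => L sLK; rewrite !ffunE /= sLK; case: ifP.
Qed.
HB.instance Definition _ :=
  GRing.isZmodMorphism.Build _ _ scfRes scfRes_is_zmod_morphism.
End Restriction.

(* Deflation: a subgroup M of G / N is L / N for L := coset N @*^-1 M. It is  *)
(* meant for N <| G.                                                          *)
Section Deflation.
Variables (gT : finGroupType) (N G : {group gT}).

Fact scfDef_subproof (f : Bstar G) (M : {group coset_of N}) xb :
    xb \in (G / N)%G -> M \subset (G / N)%G ->
  f (coset N @*^-1 (M :^ xb))%G = f (coset N @*^-1 M)%G.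
Proof.
case/morphimP=> x Nx Gx ->{xb} _; rewrite -(scfJ f (coset N @*^-1 M)%G Gx).
by congr (scf_val f _); apply/val_inj; rewrite /= morphpreJ.
Qed.

Definition scfDef (f : Bstar G) : Bstar (G / N)%G :=
  mkscf (scfDef_subproof f).

Fact scfDef_is_zmod_morphism : zmod_morphism scfDef.
Proof. by move=> f g; apply: scfP => M sM; rewrite !ffunE /= sM. Qed.
HB.instance Definition _ :=
  GRing.isZmodMorphism.Build _ _ scfDef scfDef_is_zmod_morphism.
End Deflation.

(* Deflation from A / H to A / K, where (A / H) / (K / H) is identified with  *)
(* A / K by the third isomorphism theorem: f is sent to L / K |-> f (L / H),  *)
(* for K \subset L \subset A. It is meant for H <| K, H <| A and K <| A, and  *)
(* is 0 by convention unless A normalises H.                                  *)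
Section QuotientDeflation.
Variables (gT : finGroupType) (H K A : {group gT}).

Fact scfDefq_subproof (f : Bstar (A / H)%G) (M : {group coset_of K}) xb :
    xb \in (A / K)%G -> M \subset (A / K)%G ->
  (if A \subset 'N(H) then f (coset K @*^-1 (M :^ xb) / H)%G else 0)
    = if A \subset 'N(H) then f (coset K @*^-1 M / H)%G else 0.
Proof.
case/morphimP=> x Nx Ax ->{xb} _; case: ifP => // /subsetP nHA.
have AHx : coset H x \in (A / H)%G by rewrite mem_quotient.
rewrite -(scfJ f (coset K @*^-1 M / H)%G AHx); congr (scf_val f _).
by apply/val_inj; rewrite /= -quotientJ ?nHA // morphpreJ.
Qed.

Definition scfDefq (f : Bstar (A / H)%G) : Bstar (A / K)%G :=
  mkscf (scfDefq_subproof f).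

Lemma scfDefqE f (L : {group gT}) : A \subset 'N(H) -> K <| L -> L \subset A ->
  scfDefq f (L / K)%G = f (L / H)%G.
Proof.
move=> nHA nKL sLA; rewrite mkscfE ?quotientS // nHA.
by congr (scf_val f _); apply/val_inj; rewrite /= quotientGK.
Qed.

Fact scfDefq_is_zmod_morphism : zmod_morphism scfDefq.
Proof.
by move=> f g; apply: scfP => M sM; rewrite !ffunE /= sM; case: ifP.
Qed.
HB.instance Definition _ :=
  GRing.isZmodMorphism.Build _ _ scfDefq scfDefq_is_zmod_morphism.
End QuotientDeflation.

Lemma scf_quoP (gT : finGroupType) (H A : {group gT}) (f g : Bstar (A / H)%G) :
    H \subset A -> A \subset 'N(H) ->
    (forall L : {group gT}, H <| L -> L \subset A -> f (L / H)%G = g (L / H)%G) ->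
  f = g.
Proof.
move=> sHA nHA eqfg; apply: scfP => M sMA.
have nHAn : H <| A by apply/andP.
have EM : (coset H @*^-1 M / H)%G = M by apply/val_inj; rewrite /= cosetpreK.
rewrite -EM; apply: eqfg; first by rewrite normal_cosetpre.
by rewrite -(quotientGK nHAn) morphpreS.
Qed.

Section GluingData.
Variables (gT : finGroupType) (G : {group gT}).

Definition scfDes (H : {group gT}) (f : Bstar G) : Bstar ('N_G(H) / H)%G :=
  scfDef H (scfRes 'N_G(H)%G f).

Lemma scfDesE (H : {group gT}) f (L : {group gT}) :
  H <| L -> L \subset 'N_G(H) -> scfDes H f (L / H)%G = f L.
Proof.
move=> nHL sLN; have EL : (coset H @*^-1 (L / H))%G = L.
  by apply/val_inj; rewrite /= quotientGK.
by rewrite mkscfE ?quotientS // EL scfResE ?subsetIl.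
Qed.

(* Transport of structure along conjugation by g. MathComp conjugation acts   *)
(* on the right, H :^ g = g^-1 H g, so that ^gH is H :^ g^-1.                 *)
Section Conjugation.
Variables (g : subg_of G) (H : {group gT}).
Local Notation gH := (H :^ (sgval g)^-1)%G.

Fact scfConj_subproof (f : Bstar ('N_G(H) / H)%G) (M : {group coset_of gH})
    xb : xb \in ('N_G(gH) / gH)%G -> M \subset ('N_G(gH) / gH)%G ->
  f ((coset gH @*^-1 (M :^ xb)) :^ sgval g / H)%G
    = f ((coset gH @*^-1 M) :^ sgval g / H)%G.
Proof.
case/morphimP=> x Nx /setIP[Gx _] ->{xb} _.
have Nxg : (x ^ sgval g)%g \in 'N(H).
  by rewrite -[gval H](conjsgKV (sgval g)) normJ memJ_conjg.
have NHx : coset H (x ^ sgval g)%g \in ('N_G(H) / H)%G.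
  by rewrite mem_quotient // inE Nxg groupJ ?subgP.
rewrite -(scfJ f ((coset gH @*^-1 M) :^ sgval g / H)%G NHx).
congr (scf_val f _); apply/val_inj.
by rewrite /= -quotientJ // morphpreJ // -!conjsgM -conjgC.
Qed.

Definition scfConj (f : Bstar ('N_G(H) / H)%G) : Bstar ('N_G(gH) / gH)%G :=
  mkscf (scfConj_subproof f).

Lemma scfConjE f (L : {group gT}) : gH <| L -> L \subset 'N_G(gH) ->
  scfConj f (L / gH)%G = f (L :^ sgval g / H)%G.
Proof.
move=> nHL sLN; rewrite mkscfE ?quotientS //.
by congr (scf_val f _); apply/val_inj; rewrite /= quotientGK.
Qed.

Fact scfConj_is_zmod_morphism : zmod_morphism scfConj.
Proof. by move=> f h; apply: scfP => M sM; rewrite !ffunE /= sM. Qed.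
HB.instance Definition _ :=
  GRing.isZmodMorphism.Build _ _ scfConj scfConj_is_zmod_morphism.
End Conjugation.

Definition ntsubg := {H : {group gT} | (H :!=: 1%g) && (H \subset G)}.

Fact ntsubgJ_subproof (g : subg_of G) (H : ntsubg) :
  ((val H :^ (sgval g)^-1)%G :!=: 1%g)
  && ((val H :^ (sgval g)^-1)%G \subset G).
Proof.
case: H => H /= /andP[ntH sHG]; apply/andP; split.
  apply: contra ntH => /eqP Hg1.
  by rewrite -[gval H](conjsgKV (sgval g)) Hg1 conjs1g.
by rewrite sub_conjgV conjGid ?subgP.
Qed.
Definition ntsubgJ (g : subg_of G) (H : ntsubg) : ntsubg :=
  exist _ (val H :^ (sgval g)^-1)%G (ntsubgJ_subproof g H).

Definition Bstar_family :=
  {dffun forall H : ntsubg, Bstar ('N_G(val H) / val H)%G}.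

Definition normaliser2 (H K : {group gT}) : {group gT} := ('N_G(H) :&: 'N_G(K))%G.

Definition is_gluing : {pred Bstar_family} := fun f =>
  [forall g : subg_of G, [forall H : ntsubg,
     scfConj g (f H) == f (ntsubgJ g H)]]
  && [forall H : ntsubg, [forall K : ntsubg,
     (val H <| val K) ==>
       (scfDefq (val K) (scfRes (normaliser2 (val H) (val K) / val H)%G (f H))
          == scfRes (normaliser2 (val H) (val K) / val K)%G (f K))]].

Lemma is_gluingP (f : Bstar_family) :
  reflect ((forall (g : subg_of G) (H : ntsubg),
              scfConj g (f H) = f (ntsubgJ g H))
           /\ (forall H K : ntsubg, val H <| val K ->
                 scfDefq (val K)
                   (scfRes (normaliser2 (val H) (val K) / val H)%G (f H))
                 = scfRes (normaliser2 (val H) (val K) / val K)%G (f K)))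
          (f \in is_gluing).
Proof.
apply: (iffP andP) => [[/forallP c /forallP d]|[c d]]; split.
- by move=> g H; apply/eqP/(forallP (c g)).
- by move=> H K nHK; apply/eqP/(implyP (forallP (d H) K)).
- by apply/forallP=> g; apply/forallP=> H; apply/eqP/c.
by apply/forallP=> H; apply/forallP=> K; apply/implyP=> nHK; apply/eqP/d.
Qed.

Fact is_gluing_zmod_closed : zmod_closed is_gluing.
Proof.
split=> [|f h /is_gluingP[cf df] /is_gluingP[ch dh]].
  by apply/is_gluingP; split=> *; rewrite !ffunE !raddf0.
apply/is_gluingP; split=> [g H | H K nHK]; rewrite !dffun_subE !raddfB.
  by congr (_ - _); [apply: cf | apply: ch].
by congr (_ - _); [apply: df | apply: dh].
Qed.
HB.instance Definition _ :=
  GRing.isZmodClosed.Build Bstar_family is_gluing is_gluing_zmod_closed.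

Record gluing := Gluing { gluing_val :> Bstar_family;
                          gluing_valP : gluing_val \in is_gluing }.

HB.instance Definition _ := [isSub for gluing_val].
HB.instance Definition _ := [Choice of gluing by <:].
HB.instance Definition _ := [SubChoice_isSubZmodule of gluing by <:].

Fact rG_subproof (f : Bstar G) :
  ([ffun H : ntsubg => scfDes (val H) f] : Bstar_family) \in is_gluing.
Proof.
apply/is_gluingP; split=> [g H0 | H0 K0 nHK]; rewrite !ffunE.
  have sHG := proj2 (andP (valP H0)); set H := val H0 in sHG *.
  have sgHG : (H :^ (sgval g)^-1)%G \subset G.
    by rewrite sub_conjgV conjGid ?subgP.
  apply: scf_quoP => [||L nHL sLN]; rewrite ?subIset ?subsetIidl ?subxx ?orbT //.
    by rewrite subsetI sgHG normG.
  have nHLg : H <| (L :^ sgval g)%G.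
    by rewrite -(normalJ _ _ (sgval g)^-1%g) conjsgK.
  rewrite scfConjE // !scfDesE // ?scfJ ?subgP //.
  rewrite subsetI normal_norm // andbT -(conjGid (subgP g)) conjSg.
  by apply: subset_trans sLN _; apply: subsetIl.
have sHG := proj2 (andP (valP H0)); have sKG := proj2 (andP (valP K0)).
set H := val H0 in sHG nHK *; set K := val K0 in sKG nHK *.
have sNNH : normaliser2 H K \subset 'N_G(H) by apply: subsetIl.
have sNNK : normaliser2 H K \subset 'N_G(K) by apply: subsetIr.
have nNNH : normaliser2 H K \subset 'N(H) by apply: subset_trans sNNH (subsetIr _ _).
have nNNK : normaliser2 H K \subset 'N(K) by apply: subset_trans sNNK (subsetIr _ _).
apply: scf_quoP => // [|L nKL sLN].
  by rewrite !subsetI !sKG normG (normal_norm nHK).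
have nHL : H <| L.
  apply/andP; split; last exact: subset_trans sLN nNNH.
  exact: subset_trans (normal_sub nHK) (normal_sub nKL).
rewrite scfDefqE // !scfResE ?quotientS // !scfDesE //.
  exact: subset_trans sLN sNNK.
exact: subset_trans sLN sNNH.
Qed.

Definition rG (f : Bstar G) : gluing := Gluing (rG_subproof f).

Fact rG_is_zmod_morphism : zmod_morphism rG.
Proof.
move=> f h; apply/val_inj/ffunP=> H.
by rewrite dffun_subE !ffunE /scfDes !raddfB.
Qed.
HB.instance Definition _ :=
  GRing.isZmodMorphism.Build _ _ rG rG_is_zmod_morphism.
End GluingData.

Definition short_exact (A B C : zmodType)
    (i : {additive A -> B}) (r : {additive B -> C}) : Prop :=
  [/\ injective i, forall b, r b = 0 <-> exists a, i a = b
    & forall c, exists b, r b = c].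

(* Main.v *)
Require Import Defs.
From HB Require Import structures.
From mathcomp Require Import all_boot all_order all_fingroup all_algebra.

(** A compatible family [c] is determined by its diagonal values [c_L (L / L)],
    one for each nontrivial subgroup [L] of [G]: if [1 < H <| L], then [L]
    itself lies in [N_G(H, L)], so the deflation-restriction condition for the pair
    [(H, L)] may be evaluated at [L], where it reads
    [c_H (L / H) = c_L (L / L)] ([gluing_diagE], [gluing_diag_inj]).

    The diagonal of [rG f] is [f] restricted to the nontrivial subgroups
    ([rG_diag]).  So the kernel of [rG] consists of the functions supported on
    the trivial subgroup, which is alone in its conjugacy class and may be given
    any integer value: this is the copy of [int].  Conversely, the diagonal
    [L |-> c_L (L / L)] of any gluing data is invariant under conjugation
    ([gluing_diagJ]), so with any value at the trivial subgroup it is a super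
    class function, and its image under [rG] has the same diagonal as [c]
    ([glueK]). *)

Set Implicit Arguments.
Unset Strict Implicit.
Unset Printing Implicit Defensive.

Import GRing.Theory.

Local Open Scope group_scope.
Local Open Scope ring_scope.

Section GluingSequence.
Variables (gT : finGroupType) (G : {group gT}).
Implicit Types (L : {group gT}) (H K : ntsubg G).

Fact scf_at1_subproof (n : int) L x : x \in G -> L \subset G ->
  (if (L :^ x)%G :==: 1%g then n else 0) = (if L :==: 1%g then n else 0).
Proof. by move=> _ _; rewrite !trivg_card1 /= cardJg. Qed.

Definition scf_at1 (n : int) : Bstar G := mkscf (scf_at1_subproof n).

Lemma scf_at1E n L : L \subset G -> scf_at1 n L = if L :==: 1%g then n else 0.
Proof. exact: mkscfE. Qed.

Fact scf_at1_is_zmod_morphism : zmod_morphism scf_at1.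
Proof.
move=> m n; apply: scfP => L sLG; rewrite scfB !scf_at1E //.
by case: ifP; rewrite ?subr0.
Qed.
HB.instance Definition _ :=
  GRing.isZmodMorphism.Build _ _ scf_at1 scf_at1_is_zmod_morphism.

Lemma scf_at1_inj : injective scf_at1.
Proof.
move=> m n /(congr1 (fun f : Bstar G => f 1%G)).
by rewrite !scf_at1E ?sub1G ?eqxx.
Qed.

Lemma ntsubg_sub H : val H \subset G.
Proof. by case/andP: (valP H). Qed.

Definition gluing_diag (c : gluing G) H : int :=
  gluing_val c H (val H / val H)%G.

Lemma rG_diag (f : Bstar G) H : gluing_diag (rG f) H = f (val H).
Proof.
by rewrite /gluing_diag ffunE scfDesE ?normal_refl // subsetI ntsubg_sub normG.
Qed.

(** [val K] normalises both [val H] and itself, so it is one of the subgroups at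
    which the deflation-restriction condition compares [c H] with [c K]. *)
Lemma gluing_diagE (c : gluing G) H K : val H <| val K ->
  gluing_val c H (val K / val H)%G = gluing_diag c K.
Proof.
move=> nHK; have /is_gluingP[_ /(_ H K nHK) cHK] := gluing_valP c.
have sKN : val K \subset normaliser2 G (val H) (val K).
  by rewrite !subsetI ntsubg_sub normG (normal_norm nHK).
have sN2H : normaliser2 G (val H) (val K) \subset 'N_G(val H)
  by apply: subsetIl.
have sN2K : normaliser2 G (val H) (val K) \subset 'N_G(val K)
  by apply: subsetIr.
have := congr1 (fun f : Bstar _ => f (val K / val K)%G) cHK.
rewrite scfDefqE ?normal_refl //; last exact: subset_trans sN2H (subsetIr _ _).
by rewrite !scfResE ?quotientS.
Qed.

(** Subgroups of [N_G(H) / H] are the [L / H] with [H <| L], and such an [L] is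
    again nontrivial, so by [gluing_diagE] the diagonal values determine all
    others. *)
Lemma gluing_diag_inj (c d : gluing G) :
  (forall H, gluing_diag c H = gluing_diag d H) -> c = d.
Proof.
move=> eq_cd; apply/val_inj/ffunP=> H.
apply: scf_quoP => [||L nHL sLN]; first by rewrite subsetI ntsubg_sub normG.
  exact: subsetIr.
have ntsL : (L :!=: 1%g) && (L \subset G).
  rewrite (subset_trans sLN (subsetIl _ _)) andbT.
  case/andP: (valP H) => ntH _; apply: contra ntH => /eqP L1.
  by have := normal_sub nHL; rewrite L1 subG1.
pose K : ntsubg G := exist _ L ntsL.
by rewrite -[L]/(val K) !gluing_diagE.
Qed.

Lemma gluing_diag0 H : gluing_diag 0 H = 0.
Proof.
have -> : gluing_diag 0 H
    = (0 : Bstar ('N_G(val H) / val H)%G) (val H / val H)%G.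
  by congr (scf_val _ _); apply: ffunE.
exact: ffunE.
Qed.

Lemma rG_eq0 (f : Bstar G) : rG f = 0 <-> forall H, f (val H) = 0.
Proof.
split=> [f0 H | f0]; first by rewrite -rG_diag f0 gluing_diag0.
by apply: gluing_diag_inj => H; rewrite rG_diag f0 gluing_diag0.
Qed.

Lemma gluing_diagJ (c : gluing G) (g : subg_of G) H :
  gluing_diag c (ntsubgJ g H) = gluing_diag c H.
Proof.
rewrite /gluing_diag; have /is_gluingP[/(_ g H) <- _] := gluing_valP c.
rewrite scfConjE ?normal_refl //; last first.
  by rewrite subsetI normG (ntsubg_sub (ntsubgJ g H)).
congr (scf_val (gluing_val c H) (_ / _)%G).
by apply/val_inj; rewrite /= conjsgKV.
Qed.

(** The value 0 at the trivial subgroup, where [insub] fails, is an arbitrary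
    choice; this is the ambiguity measured by the kernel of [rG]. *)
Definition glue_fun (c : gluing G) L : int :=
  oapp (gluing_diag c) 0 (insub L).

Lemma glue_fun_val (c : gluing G) H : glue_fun c (val H) = gluing_diag c H.
Proof. by rewrite /glue_fun valK. Qed.

Fact glue_subproof (c : gluing G) L x : x \in G -> L \subset G ->
  glue_fun c (L :^ x)%G = glue_fun c L.
Proof.
move=> Gx sLG; have [L1 | ntL] := eqVneq (gval L) 1%g.
  by congr glue_fun; apply/val_inj; rewrite /= L1 conjs1g.
have ntsL : (L :!=: 1%g) && (L \subset G) by rewrite ntL.
pose H : ntsubg G := exist _ L ntsL.
(* [ntsubgJ] transports along the left action, hence the inverse. *)
pose g := subg G x^-1%g.
have -> : (L :^ x)%G = val (ntsubgJ g H).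
  by apply/val_inj; rewrite /= subgK ?groupV // invgK.
by rewrite -[L]/(val H) !glue_fun_val gluing_diagJ.
Qed.

Definition glue (c : gluing G) : Bstar G := mkscf (@glue_subproof c).

Lemma glueK (c : gluing G) : rG (glue c) = c.
Proof.
apply: gluing_diag_inj => H.
by rewrite rG_diag mkscfE ?ntsubg_sub // glue_fun_val.
Qed.

End GluingSequence.

Theorem theorem3p1 (gT : finGroupType) (G : {group gT}) :
  exists i : {additive int -> Bstar G}, short_exact i (@rG gT G).
Proof.
exists (@scf_at1 gT G); split=> [|f|c]; first exact: scf_at1_inj; last first.
  by exists (glue c); apply: glueK.
split=> [/rG_eq0 f0 | [n <-]].
  exists (f 1%G); apply: scfP => L sLG; rewrite scf_at1E //.
  have [L1 | ntL] := eqVneq (gval L) 1%g.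
    by congr (scf_val f _); apply/val_inj; rewrite /= L1.
  have ntsL : (L :!=: 1%g) && (L \subset G) by rewrite ntL.
  by rewrite (f0 (exist _ L ntsL)).
apply/rG_eq0 => H; rewrite scf_at1E ?ntsubg_sub //.
by case/andP: (valP H) => /negPf->.
Qed.
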